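(* Let $d\ge 1$ and let $\mathcal{S}_{\mathrm a}$ be a convergent $d$-variate subdivision scheme with (real, finitely supported) mask $\mathrm a$. Then its mask symbol can be written in the form $$\mathrm a(\boldsymbol z)=\sum_{\Theta}\lambda_\Theta\;\sigma_\Theta(\boldsymbol z)\;2^d\,q_\Theta(\boldsymbol z),$$ where the sum runs over all unimodular $d\times d$-submatrices $\Theta$ of $\bigl(X_d^{(1)}\,|\,X_d^{(2)}\bigr)$, the $\sigma_\Theta(\boldsymbol z)$ are Laurent polynomials satisfying $\sigma_\Theta(\boldsymbol 1)=1$, and the $\lambda_\Theta$ are real numbers with $\sum_\Theta\lambda_\Theta=1$.
   Context: A mask is a finitely supported sequence $\mathrm a=(\mathrm a_\alpha)_{\alpha\in\mathbb Z^d}$ of real numbers. The associated subdivision operator acts on sequences $\mathrm d=(\mathrm d_\alpha)_{\alpha\in\mathbb Z^d}$ by $(\mathcal S_{\mathrm a}\mathrm d)_\alpha=\sum_{\beta\in\mathbb Z^d}\mathrm d_\beta\,\mathrm a_{\alpha-2\beta}$. The mask symbol is the Laurent polynomial $\mathrm a(\boldsymbol z)=\sum_{\alpha\in\mathbb Z^d}\mathrm a_\alpha\boldsymbol z^\alpha$, $\boldsymbol z\in(\mathbb C\setminus\{0\})^d$, with $\boldsymbol z^\alpha=z_1^{\alpha_1}\cdots z_d^{\alpha_d}$. The scheme is convergent if for every $\mathrm d\in\ell_\infty(\mathbb Z^d)$ there is a uniformly continuous function $f_{\mathrm d}$ on $\mathbb R^d$ with $\lim_{r\to\infty}\sup_{\alpha\in\mathbb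 Z^d}|(\mathcal S_{\mathrm a}^r\mathrm d)_\alpha-f_{\mathrm d}(2^{-r}\alpha)|=0$, and $f_{\mathrm d}\ne0$ for some $\mathrm d$. $X_d^{(1)}=I_d$ is the matrix whose columns are the standard unit vectors $e_1,\dots,e_d$, and $X_d^{(2)}$ is the matrix whose columns are the vectors $e_j+e_k$, $j\neq k$ (one column for each unordered pair). A $d\times d$-submatrix is obtained by selecting $d$ distinct columns; it is unimodular if $\det\Theta=\pm1$. For such $\Theta$, $q_\Theta(\boldsymbol z)=\prod_{\theta\in\Theta}\frac{1+\boldsymbol z^\theta}{2}$, where $\theta$ runs through the columns of $\Theta$. $\boldsymbol 1=(1,\dots,1)$. Laurent polynomials are taken with real coefficients. *)

(* Defs.v *)
From mathcomp Require Import all_boot all_order all_algebra finmap.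
From mathcomp Require Import all_classical all_reals all_analysis.
From mathcomp Require Import complex.

Set Implicit Arguments.
Unset Strict Implicit.
Unset Printing Implicit Defensive.

Import Order.TTheory GRing.Theory Num.Theory.
Import numFieldNormedType.Exports.

Local Open Scope classical_set_scope.
Local Open Scope ring_scope.
Local Open Scope complex_scope.

(* Both the lattice Z^d and R^d are modelled by column vectors, so that the
   columns of an integer matrix are multi-indices.  A finitely supported
   sequence serves as a mask and as the coefficients of a Laurent polynomial. *)
Definition Mask (R : realType) (d : nat) := {fsfun 'cV[int]_d -> R with 0}.

Definition subdivision (R : realType) (d : nat) (a : Mask R d)
    (c : 'cV[int]_d -> R) : 'cV[int]_d -> R :=
  fun alpha => \sum_(beta \in [set: 'cV[int]_d]) c beta * a (alpha - beta *+ 2).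

Definition monomial (R : realType) (d : nat) (z : 'cV[R[i]]_d)
    (alpha : 'cV[int]_d) : R[i] :=
  \prod_(i < d) z i 0 ^ alpha i 0.

Definition symbol (R : realType) (d : nat) (a : Mask R d)
    (z : 'cV[R[i]]_d) : R[i] :=
  \sum_(alpha <- finsupp a) (a alpha)%:C * monomial z alpha.

Definition ell_infty (R : realType) (d : nat) (c : 'cV[int]_d -> R) : Prop :=
  exists M : R, forall alpha, `|c alpha| <= M.

(* The supremum is taken in the extended reals: the real-valued [sup] would
   return 0 on unbounded sets. *)
Definition subdivision_limit (R : realType) (d : nat) (a : Mask R d)
    (c : 'cV[int]_d -> R) (f : 'cV[R]_d -> R) : Prop :=
  unif_continuous f /\
  ereal_sup (range (fun alpha : 'cV[int]_d =>
    `|iter r (subdivision a) c alpha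
      - f (2 ^- r *: map_mx intr alpha)|%:E)) @[r --> \oo] --> 0%E.

(* The limit function is unique when it exists, dyadic points being dense. *)
Definition convergent (R : realType) (d : nat) (a : Mask R d) : Prop :=
  (forall c, ell_infty c -> exists f, subdivision_limit a c f) /\
  (exists c f, [/\ ell_infty c, subdivision_limit a c f & f <> cst 0]).

Definition pairs (d : nat) : {set 'I_d * 'I_d} :=
  [set p : 'I_d * 'I_d | (p.1 < p.2)%N]%SET.

Definition X1 (d : nat) : 'M[int]_d := 1%:M.

Definition X2 (d : nat) : 'M[int]_(d, #|pairs d|) :=
  \matrix_(i, c) ((i == (enum_val c).1)%:R + (i == (enum_val c).2)%:R).

Definition X12 (d : nat) : 'M[int]_(d, d + #|pairs d|) := row_mx (X1 d) (X2 d).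

(* A choice of d distinct columns of X12 is encoded by the strictly increasing
   map listing their indices, so each submatrix occurs exactly once. *)
Definition selection (d : nat) := {ffun 'I_d -> 'I_(d + #|pairs d|)}.

Definition submx_of (d : nat) (s : selection d) : 'M[int]_d := colsub s (X12 d).

Definition unimodular_selection (d : nat) (s : selection d) : bool :=
  [forall i : 'I_d, forall j : 'I_d, (i < j)%N ==> (s i < s j)%N] &&
  (\det (submx_of s) \in [:: 1; -1]).

Definition q_poly (R : realType) (d : nat) (Theta : 'M[int]_d)
    (z : 'cV[R[i]]_d) : R[i] :=
  \prod_(j < d) ((1 + monomial z (col j Theta)) / 2).

(* Main.v *)
Require Import Defs.
From mathcomp Require Import all_boot all_order all_algebra finmap.
From mathcomp Require Import all_classical all_reals all_analysis.
From mathcomp Require Import complex.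
From HB Require Import structures.
From mathcomp Require Import perm ring.

(** Write A for the ring of real Laurent polynomials, x_i = (1 + z_i)/2, and Q
    for the ideal of A generated by the q_Theta, Theta unimodular.  The theorem
    says that the symbol of a convergent mask lies in Q, with coefficients that
    do not vanish at (1, ..., 1).

    Convergence gives the sum rules ([sum_rule]): the mask sums to 1 over each
    coset of 2 Z^d.  Indeed, near a point x where the limit function f is not 0,
    the data at level r are close to f x, and a value at level r + 1 is a
    combination of them whose weights are the mask entries of one coset; the
    limit r -> oo reads f x = f x * (sum over the coset).

    The heart of the proof is z_i^2 = 1 modulo Q ([sqr_coord_box_ideal]), that
    is, x_i (1 - x_i) \in Q.  The identity
      (1 + z_i z_j)/2 = x_i x_j + (1 - x_i)(1 - x_j)
    turns generators of Q into polynomials in the x_i.  A rooted forest on the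
    indices, with an edge e_l + e_k for each vertex l of parent k and a vector
    e_l for each root l, is a unimodular matrix ([forest_selection]), so its
    product lies in Q.  To see that Q contains x_i (1 - x_i), one may reason in
    the localizations of A: let K be the set of the k with x_k invertible.  If
    K is everything, the forest without edges puts an invertible element in Q.  Otherwise, for
    j \notin K, x_j is in the maximal ideal, hence x_j x_l + (1 - x_j)(1 - x_l)
    is invertible when j, l \notin K.  A star on the complement of K, rooted at
    its centre j0 or hung from k \in K, then has a single non-invertible factor,
    which is therefore 0: this gives x_j0 = 0 and then x_k = 1.  The lemma
    [ideal_unit_of_cover] replaces the maximal ideals by finitely many case
    distinctions.

    Modulo Q each monomial thus equals the product of the z_i over its odd
    exponents, and the sum rules turn the symbol into the sum of all square-free
    monomials, the product of the 1 + z_i, which is 2^d times a generator of Q.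

    Finally the coefficient of q_Theta may vanish at (1, ..., 1) although it is
    not 0.  Adding multiples of the relations q_s * q_t - q_t * q_s = 0 cures
    this ([nonvanishing_coefficients]). *)

Set Implicit Arguments.
Unset Strict Implicit.
Unset Printing Implicit Defensive.

Import Order.TTheory GRing.Theory Num.Theory.
Import numFieldNormedType.Exports.

Local Open Scope ring_scope.
Local Open Scope complex_scope.

(** * Ideals of commutative rings and products over forests *)

(** Ideals are propositional predicates because the ones below are defined by
    existential quantifiers over the ring. *)
Definition ideal (A : comPzRingType) (I : A -> Prop) : Prop :=
  [/\ I 0, forall f g, I f -> I g -> I (f + g) & forall r f, I f -> I (r * f)].

Section Ideals.
Variable A : comPzRingType.
Implicit Types (I H : A -> Prop).

Lemma ideal_sum I (T : Type) (s : seq T) (P : pred T) (F : T -> A) : ideal I ->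
  (forall t, P t -> I (F t)) -> I (\sum_(t <- s | P t) F t).
Proof. by case=> I0 ID _ IF; elim/big_ind: _. Qed.

Lemma congr_prod I (T : Type) (s : seq T) (P : pred T) (F G : T -> A) :
  ideal I -> (forall t, P t -> I (F t - G t)) ->
  I (\prod_(t <- s | P t) F t - \prod_(t <- s | P t) G t).
Proof.
move=> idI FG; case: (idI) => I0 ID IM.
elim/big_ind2: _ => //; first by rewrite subrr.
move=> g1 f1 g2 f2 I1 I2.
have -> : f1 * f2 - g1 * g2 = f2 * (f1 - g1) + g1 * (f2 - g2) by ring.
by apply: ID; apply: IM.
Qed.

Lemma ideal_adjoin I x : ideal I -> ideal (fun f => exists r, I (f - r * x)).
Proof.
case=> I0 ID IM; split=> [|f g [r If] [s Ig]|r f [s If]].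
- by exists 0; rewrite mul0r subrr.
- exists (r + s); have -> : f + g - (r + s) * x = (f - r * x) + (g - s * x) by ring.
  exact: ID.
- by exists (r * s); rewrite -mulrA -mulrBr; apply: IM.
Qed.

Lemma ideal_quotient I x : ideal I -> ideal (fun f => I (f * x)).
Proof.
case=> I0 ID IM; split=> [|f g If Ig|r f If]; first by rewrite mul0r.
- by rewrite mulrDl; apply: ID.
- by rewrite -mulrA; apply: IM.
Qed.

(** A form without maximal ideals of: an ideal that is contained in none of them
    is the whole ring.  In a residue field of the ring at H, each x_j is 0 or
    invertible; K collects the invertible ones, and [cover] produces a unit in H.
    The alternative for x_u is obtained by running the argument in H + (x_u)
    first: it yields 1 = h + r x_u, so that x_u is invertible modulo H. *)
Lemma ideal_unit_of_cover (T : finType) (x : T -> A) I : ideal I ->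
  (forall H (K : {set T}), ideal H -> (forall f, I f -> H f) ->
     (forall j, j \notin K -> H (x j)) -> H (\prod_(k in K) x k)) ->
  I 1.
Proof.
move=> idI cover.
suff decided (s : seq T) H : ideal H -> (forall f, I f -> H f) ->
    (forall i, i \notin s -> H (x i) \/ exists r, H (1 - r * x i)) -> H 1.
  apply: (decided (enum T) I) => // i; by rewrite mem_enum.
elim: s H => [|u s IHs] H idH IH dec.
  pose K := [set i | `[< exists r, H (1 - r * x i) >]].
  have [r rK] : exists r, H (1 - r * \prod_(k in K) x k).
    case: (idH) => H0 HD HM.
    apply: (big_rec (fun f => exists r, H (1 - r * f))) => [|k f].
      by exists 1; rewrite mulr1 subrr.
    rewrite inE => /asboolP[s Hs] [t Ht]; exists (s * t).
    have -> : 1 - s * t * (x k * f) = (1 - s * x k) + (s * x k) * (1 - t * f).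
      by ring.
    by apply: HD => //; apply: HM.
  have HK : H (\prod_(k in K) x k).
    by apply: cover => // j; rewrite inE => /asboolPn nj; case: (dec j).
  case: (idH) => _ HD HM; rewrite -[1](subrK (r * \prod_(k in K) x k)).
  by apply: HD => //; apply: HM.
apply: (IHs) => // i nis; have [->|niu] := eqVneq i u; last first.
  by apply: dec; rewrite inE negb_or niu.
right; apply: (IHs _ (ideal_adjoin (x u) idH)) => [f If|j njs].
  by exists 0; rewrite mul0r subr0; apply: IH.
have [->|nju] := eqVneq j u.
  by left; exists 1; rewrite mul1r subrr; case: idH.
have [|Hj|[r Hr]] := dec j; first by rewrite inE negb_or nju.
- by left; exists 0; rewrite mul0r subr0.
- by right; exists r, 0; rewrite mul0r subr0.
Qed.

Section Forests.
Variables (T : finType) (x : T -> A).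

(** If x_i = (1 + z_i)/2, this is (1 + z_i z_j)/2. *)
Definition edge i j := x i * x j + (1 - x i) * (1 - x j).

(** Here p l is the parent of l, and None if l is a root.  The condition bounds
    the depth by two, which excludes cycles and covers the stars used below. *)
Definition shallow (p : T -> option T) : Prop :=
  forall l, obind p (obind p (p l)) = None.

Definition forest_prod (p : T -> option T) : A :=
  \prod_l (if p l is Some k then edge l k else x l).

(** Given K and a vertex j0 outside, s is the product over the star with centre j0
    on the complement of K, times the x_k, k \in K, the factor of j0 itself
    excluded.  Modulo an ideal H that contains the x_j, j \notin K, s is the product of the x_k, k \in K; so it suffices that s multiplies
    x_i (1 - x_i) into Q, which follows from the two ways to complete the star at
    j0: make j0 a root, or attach it to i. *)
Lemma idempotent_of_forests (Q : A -> Prop) : ideal Q ->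
  (forall p, shallow p -> Q (forest_prod p)) ->
  forall i, Q (x i * (1 - x i)).
Proof.
move=> idQ Qforest i; case: (idQ) => _ QD QM; rewrite -[_ * _]mul1r.
apply: (ideal_unit_of_cover (x := x) (ideal_quotient _ idQ)) => H K idH QH HK.
have [KT|[j0 j0K i_or_K]] : (forall j, j \in K) \/
    exists2 j0, j0 \notin K & i = j0 \/ i \in K.
  have [iK|iK] := boolP (i \in K); last by right; exists i => //; left.
  have [/forallP|] := boolP [forall j, j \in K]; first by left.
  by rewrite negb_forall => /existsP[j jK]; right; exists j => //; right.
- apply: QH; rewrite mulrC; apply: QM.
  have := Qforest (fun=> None) (fun=> erefl).
  by rewrite /forest_prod (eq_bigl (fun j => j \in K)) // => j; rewrite KT.
pose star r l := if l \in K then None else if l == j0 then r else Some j0.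
pose s := (\prod_(k in K) x k) * \prod_(l | (l \notin K) && (l != j0)) edge l j0.
have starE r : forest_prod (star r) =
    (if r is Some k then edge j0 k else x j0) * s.
  rewrite /forest_prod (bigID (mem K)) /= [X in _ * X](bigD1 j0) //=.
  rewrite {2}/star (negbTE j0K) eqxx mulrCA /s; congr (_ * (_ * _)).
    by apply: eq_bigr => k kK; rewrite /star kK.
  apply: eq_bigr => l /andP[lK lj0].
  by rewrite /star (negbTE lK) (negbTE lj0).
have Qroot : Q (x j0 * s).
  rewrite -(starE None); apply: Qforest => l; rewrite /star.
  by case: (l \in K) => //; case: (l == j0) => //=; rewrite (negbTE j0K) eqxx.
(* If i is outside K then i = j0 by choice of j0. *)
have Qs : Q (s * (x i * (1 - x i))).
  case: i_or_K => [->|iK].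
    have -> : s * (x j0 * (1 - x j0)) = (1 - x j0) * (x j0 * s) by ring.
    exact: QM.
  have Qedge : Q (edge j0 i * s).
    rewrite -(starE (Some i)); apply: Qforest => l; rewrite /star.
    case: (l \in K) => //; case: (l == j0) => /=; first by rewrite iK.
    by rewrite (negbTE j0K) eqxx /= iK.
  have -> : s * (x i * (1 - x i)) = x i * (edge j0 i * s)
      + (x i * (1 - x i - x i)) * (x j0 * s) by rewrite /edge; ring.
  by apply: QD; apply: QM.
have Hs : H s by apply: QH.
case: (idH) => H0 HD HM.
pose E := \prod_(l | (l \notin K) && (l != j0)) edge l j0.
(* Each edge factor is 1 modulo H, both its ends being outside K. *)
have HE : H (1 - E).
  have := @congr_prod H T (index_enum T) (fun l => (l \notin K) && (l != j0))
    (fun=> 1) (fun l => edge l j0) idH.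
  rewrite big1_eq; apply=> l /andP[lK _].
  have -> : 1 - edge l j0 = (1 - x j0 - x j0) * x l + 1 * x j0.
    by rewrite /edge; ring.
  by apply: HD; apply: HM; apply: HK.
have -> : \prod_(k in K) x k = s + (\prod_(k in K) x k) * (1 - E).
  by rewrite /s /E; ring.
by apply: HD => //; apply: HM.
Qed.

End Forests.
End Ideals.

(** * Unimodular submatrices from forests *)

Section ForestColumns.
Variable d : nat.
Implicit Types p : 'I_d -> option 'I_d.

(** The matrix 1 + parent_mx p has the columns e_l (l a root) and e_l + e_k (l of
    parent k). *)
Definition parent_mx p : 'M[int]_d := \matrix_(i, l) (p l == Some i)%:R.

Lemma parent_mxM p q :
  parent_mx p *m parent_mx q = parent_mx (fun l => obind p (q l)).
Proof.
apply/matrixP => i l; rewrite !mxE; case ql: (q l) => [k|] /=.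
  rewrite (bigD1 k) //= !mxE ql eqxx mulr1 big1 ?addr0 // => j jk.
  by rewrite !mxE ql [Some k == _]eq_sym (inj_eq Some_inj) (negbTE jk) mulr0.
by rewrite big1 // => j _; rewrite !mxE ql mulr0.
Qed.

(** A parent matrix is nilpotent, because iterated parents run out. *)
Lemma forest_unitmx p : shallow p -> 1%:M + parent_mx p \in unitmx.
Proof.
move=> p3; set N := parent_mx p.
have N3 : N *m (N *m N) = 0.
  rewrite !parent_mxM; apply/matrixP => i l; rewrite !mxE.
  by have := p3 l => /= ->.
suff /mulmx1_unit[] : (1%:M + N) *m (1%:M - N + N *m N) = 1%:M by [].
rewrite mulmxDl mul1mx mulmxDr mulmxBr mulmx1 N3 addr0.
by rewrite addrACA subrK subrr addr0.
Qed.

Lemma forest_column p l : shallow p ->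
  exists c, col c (X12 d) = col l (1%:M + parent_mx p).
Proof.
move=> p3; case pl: (p l) => [k|]; last first.
  exists (lshift _ l); apply/colP => i.
  by rewrite !mxE (unsplitK (inl _)) !mxE pl addr0.
have kl : k != l.
  apply/eqP => kl; have := p3 l.
  by rewrite pl /= kl pl /= kl pl.
(* The columns of X2 are indexed by the increasing pairs only. *)
wlog [u [v [uv ukl]]] : / exists u v : 'I_d, (u < v)%N /\
    forall i : 'I_d, (i == u)%:R + (i == v)%:R
       = (i == l)%:R + (i == k)%:R :> int.
  apply; have [kl'|lk|e] := ltngtP k l.
  - by exists k, l; split=> // i; rewrite addrC.
  - by exists l, k.
  - by rewrite (val_inj e) eqxx in kl.
have uvP : (u, v) \in pairs d by rewrite inE.
exists (rshift _ (enum_rank_in uvP (u, v))); apply/colP => i.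
rewrite !mxE (unsplitK (inr _)) !mxE enum_rankK_in //= ukl pl.
by rewrite (inj_eq Some_inj) (eq_sym k).
Qed.

(** A selection lists its columns in increasing order, so an arbitrary list of
    columns has to be sorted; this changes the determinant by a sign only. *)
Lemma selection_of_columns (g : 'I_d -> 'I_(d + #|pairs d|)) :
  colsub g (X12 d) \in unitmx ->
  exists2 s : selection d, unimodular_selection s &
    exists t : {perm 'I_d}, forall j, s j = g (t j).
Proof.
move=> gU.
have g_inj : injective g.
  move=> l l' gll'; apply/eqP; apply: contraT => ll'.
  have := gU; rewrite unitmxE -det_tr (determinant_alternate ll') ?unitr0 //.
  by move=> i; rewrite !mxE gll'.
pose B := [set g l | l in 'I_d]%SET.
have cB : #|B| = d by rewrite card_imset // card_ord.
pose s : selection d := [ffun j => Order.enum_val (cast_ord (esym cB) j)].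
have sB j : s j \in codom g.
  rewrite ffunE; have /imsetP[l _ ->] := Order.enum_valP (cast_ord (esym cB) j).
  exact: codom_f.
pose t j := iinv (sB j).
have gt j : g (t j) = s j by exact: f_iinv.
have s_incr (i j : 'I_d) : (i < j)%N -> (s i < s j)%N.
  move=> ij; rewrite !ffunE.
  have e := leW_mono (@Order.le_enum_val _ _ (@le_total _ 'I_(d + #|pairs d|)) (mem B)).
  have := e (cast_ord (esym cB) i) (cast_ord (esym cB) j).
  by move=> lt_s; exact: etrans lt_s ij.
have t_inj : injective t.
  move=> i j /(congr1 g); rewrite !gt => sij; apply: val_inj => /=.
  by case: (ltngtP i j) => // /s_incr; rewrite sij ltnn.
exists s; last by exists (perm t_inj) => j; rewrite permE gt.
apply/andP; split.
  by apply/'forall_'forall_implyP => i j; exact: s_incr.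
have : submx_of s \in unitmx.
  have -> : submx_of s = col_perm (perm t_inj) (colsub g (X12 d)).
    by apply/matrixP => i j; rewrite !mxE permE gt.
  by rewrite col_permE unitmx_mul gU unitmx_perm.
by rewrite unitmxE !inE => detU; exact: detU.
Qed.

(** The product formula is stated for any F because what is needed of the
    selection is the factorization of its q_Theta, which ignores the order of the
    columns. *)
Lemma forest_selection p : shallow p ->
  exists2 s : selection d, unimodular_selection s &
    forall (A : comPzRingType) (F : 'cV[int]_d -> A),
      \prod_j F (col j (submx_of s)) = \prod_l F (col l (1%:M + parent_mx p)).
Proof.
move=> p3.
have [g gE] := choice (fun l => forest_column l p3).
have gP : colsub g (X12 d) = 1%:M + parent_mx p.
  by apply/matrixP => i l; rewrite mxE; have /colP/(_ i) := gE l; rewrite !mxE.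
have [|s sU [t st]] := @selection_of_columns g; first by rewrite gP forest_unitmx.
exists s => // A F; rewrite [RHS](reindex_inj (@perm_inj _ t)) /=.
apply: eq_bigr => j _; rewrite -gE -st; congr F.
by apply/colP => i; rewrite !mxE.
Qed.

End ForestColumns.

(** * The ring of real Laurent polynomials *)

Section Laurent.
Variables (R : realType) (d : nat).

(** Laurent polynomials are represented by the functions that they define on the
    complex torus, where the symbols are evaluated; sums and products of such
    functions are pointwise, so no convolution is needed. *)
Definition torus := {z : 'cV[R[i]]_d | [forall i, z i 0 != 0]}.

Definition laurent_sum (s : seq (R * 'cV[int]_d)) : torus -> R[i] :=
  fun z => \sum_(t <- s) (t.1)%:C * monomial (val z) t.2.

Definition is_laurent : pred (torus -> R[i]) :=
  fun f => `[< exists s, f = laurent_sum s >].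

Lemma monomialD (z : torus) (u v : 'cV[int]_d) :
  monomial (val z) (u + v) = monomial (val z) u * monomial (val z) v.
Proof.
rewrite /monomial -big_split; apply: eq_bigr => i _ /=.
by rewrite mxE expfzDr //; apply/(forallP (valP z)).
Qed.

Lemma monomial0 (z : 'cV[R[i]]_d) : monomial z 0 = 1.
Proof. by rewrite /monomial big1 // => i _; rewrite mxE. Qed.

Lemma is_laurent_subring : subring_closed is_laurent.
Proof.
split.
- apply/asboolP; exists [:: (1, 0)]; apply/funext => z.
  by rewrite /laurent_sum big_seq1 /= monomial0 mulr1.
- move=> _ _ /asboolP[s ->] /asboolP[t ->]; apply/asboolP.
  exists (s ++ [seq (- u.1, u.2) | u <- t]); apply/funext => z.
  rewrite /laurent_sum big_cat big_map /=; congr (_ + _).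
  have -> : (- laurent_sum t) z = - laurent_sum t z by [].
  rewrite /laurent_sum -sumrN; apply: eq_bigr => u _.
  by rewrite rmorphN mulNr.
- move=> _ _ /asboolP[s ->] /asboolP[t ->]; apply/asboolP.
  exists [seq (u.1 * v.1, u.2 + v.2) | u <- s, v <- t]; apply/funext => z.
  have -> : (laurent_sum s * laurent_sum t) z = laurent_sum s z * laurent_sum t z by [].
  rewrite /laurent_sum big_allpairs_dep /= big_distrlr /=.
  apply: eq_bigr => u _; apply: eq_bigr => v _.
  by rewrite monomialD rmorphM mulrACA.
Qed.
HB.instance Definition _ := GRing.isSubringClosed.Build (torus -> R[i])
  is_laurent is_laurent_subring.

Record laurent := Laurent { laurent_val : torus -> R[i]; _ : is_laurent laurent_val }.
HB.instance Definition _ := [isSub for laurent_val].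
HB.instance Definition _ := [Choice of laurent by <:].
HB.instance Definition _ :=
  GRing.SubChoice_isSubComPzRing.Build _ _ laurent (GRing.subringClosedP _).

Definition ev (z : torus) (f : laurent) : R[i] := laurent_val f z.

Lemma ev_zmod z : zmod_morphism (ev z).
Proof. by move=> f g. Qed.
Lemma ev_monoid z : monoid_morphism (ev z).
Proof. by split=> // f g. Qed.
HB.instance Definition _ z := GRing.isZmodMorphism.Build _ _ (ev z) (ev_zmod z).
HB.instance Definition _ z := GRing.isMonoidMorphism.Build _ _ (ev z) (ev_monoid z).

Lemma evM z f g : ev z (f * g) = ev z f * ev z g.
Proof. by []. Qed.

Lemma evD z f g : ev z (f + g) = ev z f + ev z g.
Proof. by []. Qed.

Lemma evB z f g : ev z (f - g) = ev z f - ev z g.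
Proof. by []. Qed.

Lemma ev_sum z (I : Type) (r : seq I) (P : pred I) (F : I -> laurent) :
  ev z (\sum_(i <- r | P i) F i) = \sum_(i <- r | P i) ev z (F i).
Proof. exact: rmorph_sum. Qed.

Lemma ev_prod z (I : Type) (r : seq I) (P : pred I) (F : I -> laurent) :
  ev z (\prod_(i <- r | P i) F i) = \prod_(i <- r | P i) ev z (F i).
Proof. exact: rmorph_prod. Qed.

Lemma laurentP f g : (forall z, ev z f = ev z g) -> f = g.
Proof. by move=> fg; apply: val_inj; apply/funext => z; exact: fg. Qed.

Lemma term_laurent c alpha : is_laurent (laurent_sum [:: (c, alpha)]).
Proof. by apply/asboolP; exists [:: (c, alpha)]. Qed.

Definition lterm c alpha : laurent := Laurent (term_laurent c alpha).

Lemma ev_lterm z c alpha : ev z (lterm c alpha) = c%:C * monomial (val z) alpha.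
Proof. exact: big_seq1. Qed.

Lemma ltermM c b alpha beta :
  lterm c alpha * lterm b beta = lterm (c * b) (alpha + beta).
Proof.
apply: laurentP => z.
by rewrite evM !ev_lterm rmorphM monomialD mulrACA.
Qed.

Definition lconst c := lterm c 0.
Lemma ev_lconst z c : ev z (lconst c) = c%:C.
Proof. by rewrite ev_lterm monomial0 mulr1. Qed.

Definition lmono alpha := lterm 1 alpha.
Lemma ev_lmono z alpha : ev z (lmono alpha) = monomial (val z) alpha.
Proof. by rewrite ev_lterm mul1r. Qed.

Definition mask_laurent (a : Mask R d) : laurent :=
  \sum_(alpha <- finsupp a) lterm (a alpha) alpha.

Lemma ev_mask_laurent z a : ev z (mask_laurent a) = symbol a (val z).
Proof. by rewrite rmorph_sum; apply: eq_bigr => alpha _; exact: ev_lterm. Qed.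

(** The terms of an arbitrary expression may repeat exponents; collecting them
    gives a mask. *)
Lemma mask_laurent_surj f : exists a, f = mask_laurent a.
Proof.
have /asboolP[s fs] : is_laurent (laurent_val f) by case: f.
have [k kP] : exists k : {fset 'cV[int]_d}, {subset [seq u.2 | u <- s] <= k}.
  by exists (seq_fset tt [seq u.2 | u <- s]) => b; rewrite seq_fsetE.
exists [fsfun alpha in k => \sum_(u <- s | u.2 == alpha) u.1].
set a := [fsfun alpha in k => _].
apply: laurentP => z; rewrite ev_mask_laurent /symbol.
have ak : (finsupp a `<=` k)%fset by exact: finsupp_sub.
rewrite (big_fset_incl _ ak) => [|alpha _ /fsfun_dflt ->]; last by rewrite mul0r.
transitivity (\sum_(alpha <- k) \sum_(u <- s | u.2 == alpha)
    u.1%:C * monomial (val z) u.2); last first.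
  apply: eq_big_seq => alpha alphak; rewrite fsfunE alphak rmorph_sum mulr_suml.
  by apply: eq_bigr => u /eqP ->.
rewrite (exchange_big_dep predT) //= /ev fs; apply: eq_big_seq => u us.
have uk : u.2 \in k by apply: kP; exact: map_f.
rewrite big_mkcond (bigD1_seq u.2) ?fset_uniq //= eqxx big1 ?addr0 // => alpha nu.
by rewrite eq_sym (negbTE nu).
Qed.
End Laurent.

(** * The ideal generated by the box spline symbols *)

Section BoxSplineIdeal.
Variables (R : realType) (d : nat).
Local Notation laurent := (laurent R d).
Local Notation lconst := (@lconst R d).
Local Notation lmono := (@lmono R d).

(** The factor (1 + z^v)/2 of q_Theta. *)
Definition half_binomial (v : 'cV[int]_d) : laurent :=
  lconst 2^-1 * (1 + lmono v).

Definition box_symbol (s : selection d) : laurent :=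
  \prod_j half_binomial (col j (submx_of s)).

Definition box_ideal (f : laurent) : Prop :=
  exists p : selection d -> laurent,
    f = \sum_(s | unimodular_selection s) p s * box_symbol s.

Lemma ideal_box_ideal : ideal box_ideal.
Proof.
split=> [|_ _ [p ->] [r ->]|r _ [p ->]].
- by exists (fun=> 0); rewrite big1 // => s _; rewrite mul0r.
- exists (fun s => p s + r s); rewrite -big_split.
  by apply: eq_bigr => s _; rewrite mulrDl.
- by exists (fun s => r * p s); rewrite mulr_sumr; apply: eq_bigr => s _; rewrite mulrA.
Qed.

Lemma lconstD b c : lconst (b + c) = lconst b + lconst c.
Proof. by apply: laurentP => z; rewrite evD !ev_lconst rmorphD. Qed.

Lemma lconst1 : lconst 1 = 1.
Proof. by apply: laurentP => z; rewrite ev_lconst. Qed.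

Lemma lconstM b c : lconst (b * c) = lconst b * lconst c.
Proof. by rewrite ltermM addr0. Qed.

Lemma lconst_sum (I : Type) (r : seq I) (P : pred I) (F : I -> R) :
  lconst (\sum_(i <- r | P i) F i) = \sum_(i <- r | P i) lconst (F i).
Proof.
apply: laurentP => z; rewrite ev_lconst ev_sum rmorph_sum.
by apply: eq_bigr => i _; rewrite ev_lconst.
Qed.

Lemma lmonoD u v : lmono (u + v) = lmono u * lmono v.
Proof. by rewrite ltermM mulr1. Qed.

Lemma lmono0 : lmono 0 = 1.
Proof. exact: lconst1. Qed.

Lemma lconst_half : lconst 2^-1 + lconst 2^-1 = 1.
Proof. by rewrite -lconstD -lconst1 [in RHS](splitr 1) mul1r. Qed.

(** The identity that makes the generators of the ideal forest products in the
    elements (1 + z_i)/2. *)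
Lemma half_binomialD u v : half_binomial (u + v) =
  half_binomial u * half_binomial v
  + (1 - half_binomial u) * (1 - half_binomial v).
Proof.
have compl w : 1 - half_binomial w = lconst 2^-1 * (1 - lmono w).
  rewrite -[X in X - _]lconst_half /half_binomial.
  by move: (lconst _) (lmono w) => h m; ring.
rewrite !compl /half_binomial lmonoD.
move: (lconst _) (lmono u) (lmono v) lconst_half => h a b hh.
(* The two sides have degrees 1 and 2 in h = 1/2; the factor h + h = 1 homogenizes. *)
rewrite -[LHS]mulr1 -[X in _ * X = _]hh; ring.
Qed.

Definition unit_vec (i : 'I_d) : 'cV[int]_d := col i 1%:M.

Lemma forest_prod_box_ideal (p : 'I_d -> option 'I_d) : shallow p ->
  box_ideal (forest_prod (half_binomial \o unit_vec) p).
Proof.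
case: ideal_box_ideal => _ _ IM p3; have [s sU sp] := forest_selection p3.
have -> : forest_prod (half_binomial \o unit_vec) p = box_symbol s.
  rewrite /box_symbol sp; apply: eq_bigr => l _.
  case pl: (p l) => [k|]; rewrite /edge /= -?half_binomialD; congr half_binomial.
    by apply/colP => i; rewrite !mxE pl (inj_eq Some_inj) (eq_sym k).
  by apply/colP => i; rewrite !mxE pl addr0.
exists (fun t => (t == s)%:R); rewrite (bigD1 s) //= eqxx mul1r big1 ?addr0 //.
by move=> t /andP[_ /negbTE ->]; rewrite mul0r.
Qed.

(** With z = 2 x - 1, the polynomial z^2 - 1 is -4 x (1 - x). *)
Lemma sqr_coord_box_ideal i : box_ideal (lmono (unit_vec i *+ 2) - 1).
Proof.
case: ideal_box_ideal => _ _ IM.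
have := idempotent_of_forests ideal_box_ideal forest_prod_box_ideal i.
set x := _ i => /(IM (- (1 + 1 + 1 + 1))).
have zE : lmono (unit_vec i) = x + x - 1.
  by rewrite /x /= /half_binomial -mulrDl lconst_half; ring.
by congr box_ideal; rewrite mulr2n lmonoD zE; ring.
Qed.

Lemma even_power_box_ideal i (n : int) :
  box_ideal (lmono (unit_vec i *~ (n * 2)) - 1).
Proof.
case: (ideal_box_ideal) => I0 ID IM.
have natP (m : nat) : box_ideal (lmono (unit_vec i *~ (m%:Z * 2)) - 1).
  elim: m => [|m IHm]; first by rewrite mul0r mulr0z lmono0 subrr.
  rewrite intS mulrDl mul1r mulrzDr lmonoD -[X in _ - X](mulr1 1).
  set u := lmono _; set v := lmono _.
  have -> : u * v - 1 * 1 = v * (u - 1) + (v - 1) by ring.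
  by apply: ID => //; apply: IM; exact: sqr_coord_box_ideal.
case: n => m; first exact: natP.
have := natP m.+1; rewrite NegzE mulNr mulrNz.
set w := unit_vec i *~ _ => /(IM (- lmono (- w))).
congr box_ideal; rewrite mulNr mulrBr mulr1 -lmonoD addNr lmono0; ring.
Qed.

Definition odd_part (alpha : 'cV[int]_d) : {set 'I_d} :=
  [set i | (alpha i ord0 %% 2)%Z == 1]%SET.

Lemma unit_vecMz i (n : int) k : (unit_vec i *~ n) k 0 = n *+ (k == i).
Proof. by rewrite -scaler_int intz !mxE mulr_natr. Qed.

Lemma lmono_coords alpha : lmono alpha = \prod_i lmono (unit_vec i *~ alpha i 0).
Proof.
apply: laurentP => z; rewrite ev_prod ev_lmono /monomial; apply: eq_bigr => i _.
rewrite ev_lmono /monomial (bigD1 i) //= unit_vecMz eqxx big1 ?mulr1 // => k ki.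
by rewrite unit_vecMz (negbTE ki).
Qed.

Lemma lmono_mod_box_ideal alpha :
  box_ideal (lmono alpha - \prod_(i in odd_part alpha) lmono (unit_vec i)).
Proof.
rewrite lmono_coords [X in _ - X]big_mkcond /=.
apply: (@congr_prod _ _ _ _ _ _ _ ideal_box_ideal) => i _; rewrite inE.
rewrite {1}(divz_eq (alpha i 0) 2) mulrzDr lmonoD.
case: ideal_box_ideal => _ _ IM.
have := IM _ _ (even_power_box_ideal i (alpha i ord0 %/ 2)%Z).
have : (0 <= (alpha i ord0 %% 2)%Z) && ((alpha i ord0 %% 2)%Z < 2).
  by rewrite modz_ge0 // ltz_pmod.
case: (_ %% 2)%Z => // -[|[|//]] _ /=.
  by rewrite mulr0z lmono0 mulr1 => /(_ 1); rewrite mul1r.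
by rewrite mulr1z => /(_ (lmono (unit_vec i))); rewrite mulrBr mulr1 mulrC.
Qed.

(** Reduced modulo z_i^2 = 1, a symbol only depends on the sums of the mask over
    the cosets of 2 Z^d; when they are all 1 it becomes the sum of all
    square-free monomials, which factors as the product of the 1 + z_i. *)
Lemma sum_rule_box_ideal (a : Mask R d) :
  (forall S, \sum_(alpha <- finsupp a | odd_part alpha == S) a alpha = 1) ->
  box_ideal (mask_laurent a).
Proof.
move=> sum_rule; case: (ideal_box_ideal) => I0 ID IM.
pose Z (S : {set 'I_d}) := \prod_(i in S) lmono (unit_vec i).
have -> : mask_laurent a =
    \sum_(alpha <- finsupp a) lconst (a alpha) * (lmono alpha - Z (odd_part alpha))
    + \sum_(alpha <- finsupp a) lconst (a alpha) * Z (odd_part alpha).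
  rewrite -big_split; apply: eq_bigr => alpha _.
  by rewrite /= mulrBr subrK ltermM mulr1 add0r.
apply: ID.
  apply: (ideal_sum _ ideal_box_ideal) => alpha _.
  exact/IM/lmono_mod_box_ideal.
have -> : \sum_(alpha <- finsupp a) lconst (a alpha) * Z (odd_part alpha) =
    \sum_S Z S.
  rewrite (partition_big odd_part predT) //=; apply: eq_bigr => S _.
  rewrite -[RHS]mul1r -lconst1 -(sum_rule S) lconst_sum mulr_suml.
  by apply: eq_bigr => alpha /eqP ->.
have -> : \sum_S Z S = (\prod_(i < d) (1 + 1)) *
    forest_prod (half_binomial \o unit_vec) (fun=> None).
  rewrite /forest_prod -big_split /= (eq_bigr (fun i => lmono (unit_vec i) + 1)).
    by rewrite bigA_distr; apply: eq_bigr => S _; rewrite /Z big_mkcond.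
  move=> i _; rewrite mulrDl mul1r /half_binomial -mulrDl lconst_half mul1r.
  exact: addrC.
by apply/IM/forest_prod_box_ideal.
Qed.

End BoxSplineIdeal.

(** * Sum rules of a convergent scheme *)

Local Open Scope classical_set_scope.

Section SumRules.
Variables (R : realType) (d : nat).
Implicit Types (a : Mask R d) (c : 'cV[int]_d -> R) (alpha eta : 'cV[int]_d).

Definition parity_vec (S : {set 'I_d}) : 'cV[int]_d := \col_i (i \in S)%:R.
Definition half_vec alpha : 'cV[int]_d := \col_i (alpha i ord0 %/ 2)%Z.

Lemma half_odd_part alpha :
  alpha = half_vec alpha *+ 2 + parity_vec (odd_part alpha).
Proof.
apply/colP => i; rewrite mulr2n !mxE inE {1}(divz_eq (alpha i 0) 2).
congr (_ + _); first by ring.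
have : (0 <= (alpha i ord0 %% 2)%Z) && ((alpha i ord0 %% 2)%Z < 2).
  by rewrite modz_ge0 // ltz_pmod.
by case: (_ %% 2)%Z => [[|[|n]]|n].
Qed.

Lemma half_vecD eta S : half_vec (eta *+ 2 + parity_vec S) = eta.
Proof.
apply/colP => i; rewrite mulr2n !mxE.
have -> : eta i ord0 + eta i ord0 + (i \in S)%:R = eta i 0 * 2 + (i \in S)%:R.
  by ring.
by rewrite divzMDl //; case: (i \in S); rewrite addr0.
Qed.

Lemma odd_partD eta S : odd_part (eta *+ 2 + parity_vec S) = S.
Proof.
apply/setP => i; rewrite inE mulr2n !mxE.
have -> : eta i ord0 + eta i ord0 + (i \in S)%:R = eta i 0 * 2 + (i \in S)%:R.
  by ring.
by rewrite modzMDl; case: (i \in S).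
Qed.

(** Each value on the refined grid is a combination of neighbouring coarse values,
    the weights being the mask entries in the coset of the fine grid point. *)
Lemma subdivision_coset a c eta S :
  subdivision a c (eta *+ 2 + parity_vec S) =
  \sum_(alpha <- finsupp a | odd_part alpha == S) c (eta - half_vec alpha) * a alpha.
Proof.
rewrite /subdivision.
pose r := [seq eta - half_vec alpha |
           alpha <- [seq alpha <- finsupp a | odd_part alpha == S]].
rewrite (@fsbigE _ _ _ _ _ r).
- rewrite big_map big_filter_cond; apply: eq_big => [alpha|alpha /andP[/eqP aS _]].
    by rewrite in_setT andbT.
  congr (_ * a _); rewrite {2}(half_odd_part alpha) aS mulrnBl opprB addrC addrA.
  by rewrite subrK.
- rewrite map_inj_in_uniq ?filter_uniq ?fset_uniq // => alpha beta.
  rewrite !mem_filter => /andP[/eqP aS _] /andP[/eqP bS _] /addrI /oppr_inj ab.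
  by rewrite (half_odd_part alpha) (half_odd_part beta) ab aS bS.
- by [].
move=> beta _ /negP nr; rewrite fsfun_dflt ?mulr0 //; apply/negP => ar; apply: nr.
apply/mapP; exists (eta *+ 2 + parity_vec S - beta *+ 2).
  rewrite mem_filter ar andbT.
  by rewrite addrAC -mulrnBl odd_partD.
by rewrite addrAC -mulrnBl half_vecD subKr.
Qed.

(** Uniform convergence lets the evaluation point move with the level: the dyadic
    points only have to approach x. *)
Lemma subdivision_limit_cvg a c (f : 'cV[R]_d -> R) (x : 'cV[R]_d)
    (alpha : nat -> 'cV[int]_d) :
  subdivision_limit a c f ->
  (forall i, 2 ^- r * (alpha r i 0)%:~R @[r --> \oo] --> x i 0) ->
  iter r (subdivision a) c (alpha r) @[r --> \oo] --> f x.
Proof.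
move=> [/unif_continuousP fu fsup] alphax; apply/cvgrPdist_lt => e e0.
have e2 : 0 < e / 2 by rewrite divr_gt0.
have [delta /= delta0 fdelta] := fu _ e2.
have near_f : \forall r \near \oo, `|f x - f (2 ^- r *: map_mx intr (alpha r))| < e / 2.
  have : \forall r \near \oo, forall i, `|x i 0 - 2 ^- r * (alpha r i 0)%:~R| < delta.
    by apply: filter_forall => i; move/cvgrPdist_lt: (alphax i); apply.
  apply: filterS => r dxr.
  apply: (fdelta (x, _)); split=> // i j; rewrite !mxE ord1; exact: dxr.
have near_sup : \forall r \near \oo,
    `|iter r (subdivision a) c (alpha r) - f (2 ^- r *: map_mx intr (alpha r))| < e / 2.
  have : \forall r \near \oo, (ereal_sup (range (fun beta : 'cV[int]_d =>
    `|iter r (subdivision a) c beta - f (2 ^- r *: map_mx intr beta)|%:E))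
      < (e / 2)%:E)%E.
    by apply: (fsup [set y | (y < (e / 2)%:E)%E]); apply: open_ereal_lt'; rewrite lte_fin.
  apply: filterS => r; rewrite -lte_fin; apply: le_lt_trans.
  by apply: ereal_sup_ubound; exists (alpha r).
near=> r.
rewrite (splitr e) -[_ - _](subrKA (f (2 ^- r *: map_mx intr (alpha r)))).
rewrite (le_lt_trans (ler_normD _ _)) // ltrD //; first by near: r.
by rewrite distrC; near: r.
Unshelve. all: by end_near.
Qed.

Definition dyadic_floor (x : 'cV[R]_d) (r : nat) : 'cV[int]_d :=
  \col_i Num.floor (2 ^+ r * x i 0).

Lemma cvg_half_pow (u : R) : (2 ^- r * u) @[r --> \oo] --> (0 : R).
Proof.
rewrite -[0](mul0r u); apply: cvgMl.
under eq_fun do rewrite -exprVn.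
by apply: cvg_expr; rewrite ger0_norm ?invf_lt1 // ltr1n.
Qed.

Lemma dyadic_floor_cvg x i : 2 ^- r * (dyadic_floor x r i 0)%:~R @[r --> \oo] --> x i 0.
Proof.
apply: (squeeze_cvgr (f := fun r => x i 0 - 2 ^- r * 1) (h := fun=> x i 0)).
- near=> r; rewrite mxE.
  have p0 : 0 < (2 ^+ r : R) by rewrite exprn_gt0.
  rewrite lerBlDr -mulrDr ![2 ^- r * _]mulrC ler_pdivrMr // ler_pdivlMr //.
  have /andP[lo hi] := floor_itv (2 ^+ r * x i 0).
  by rewrite ![x i 0 * _]mulrC lo andbT -[1]/(1%:~R) -intrD ltW.
- rewrite -[X in _ --> X](subr0 (x i 0)); apply: cvgB; first exact: cvg_cst.
  exact: cvg_half_pow.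
- exact: cvg_cst.
Unshelve. all: by end_near.
Qed.

(** The same limit f x is computed twice along fine grid points of the coset S that
    tend to x: directly, and through the coarse values, all of which tend
    to f x. *)
Lemma sum_rule a : convergent a ->
  forall S, \sum_(alpha <- finsupp a | odd_part alpha == S) a alpha = 1.
Proof.
move=> [_ [c [f [_ cf /eqP f0]]]] S.
have [x fx0] : exists x, f x != 0.
  apply: contrapT => nf; apply/negP: f0; rewrite negbK; apply/eqP/funext => x /=.
  by apply/eqP; apply: contraT => fx; case: nf; exists x.
pose D r := iter r (subdivision a) c.
pose gamma := dyadic_floor x.
have coarse eta : D r (gamma r - eta) @[r --> \oo] --> f x.
  apply: (subdivision_limit_cvg cf) => i.
  have -> : (fun r => 2 ^- r * ((gamma r - eta) i 0)%:~R) =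
      (fun r => 2 ^- r * (gamma r i 0)%:~R - 2 ^- r * (eta i 0)%:~R) :> (nat -> R).
    by apply/funext => r; rewrite -mulrBr !mxE intrB.
  rewrite -(subr0 (x i 0)).
  by apply: cvgB; [exact: dyadic_floor_cvg|exact: cvg_half_pow].
have fine_grid : D r.+1 (gamma r *+ 2 + parity_vec S) @[r --> \oo] --> f x.
  pose alpha r := gamma r.-1 *+ 2 + parity_vec S.
  rewrite (@cvg_shiftS _ (fun r => D r (alpha r))).
  apply: (subdivision_limit_cvg cf) => i.
  rewrite -cvg_shiftS.
  have -> : (fun r => 2 ^- r.+1 * (alpha r.+1 i 0)%:~R) =
      (fun r => 2 ^- r * (gamma r i 0)%:~R
         + 2 ^- r * (2^-1 * (parity_vec S i 0)%:~R)) :> (nat -> R).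
    apply/funext => r; rewrite /alpha /= mulr2n !mxE !intrD exprS invfM.
    by field.
  rewrite -(addr0 (x i 0)).
  by apply: cvgD; [exact: dyadic_floor_cvg|exact: cvg_half_pow].
have lim : D r.+1 (gamma r *+ 2 + parity_vec S) @[r --> \oo] -->
    \sum_(alpha <- finsupp a | odd_part alpha == S) f x * a alpha.
  under eq_fun do rewrite /D iterS subdivision_coset.
  apply: cvg_big => [|alpha _]; first exact: add_continuous.
  by apply: cvgMl; exact: coarse.
have := @cvg_unique _ (@Rhausdorff R) _ _ _ _ fine_grid lim.
rewrite -mulr_sumr => fxS; apply: (mulfI fx0).
by rewrite mulr1; apply/esym/fxS; exact: fmap_proper_filter.
Qed.
End SumRules.

Local Close Scope classical_set_scope.

(** * Coefficients that do not vanish at (1, ..., 1) *)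

Section Normalization.
Variables (R : realType) (d : nat).
Implicit Types (f : laurent R d) (s : selection d).

Lemma torus1_proof : [forall i, (const_mx 1 : 'cV[R[i]]_d) i 0 != 0].
Proof. by apply/forallP => i; rewrite mxE oner_neq0. Qed.

Definition torus1 : torus R d :=
  exist (fun z : 'cV[R[i]]_d => is_true [forall i, z i 0 != 0]) _ torus1_proof.

Definition value1 f : R := complex.Re (ev torus1 f).

Lemma ev_torus1_mask (a : Mask R d) :
  ev torus1 (mask_laurent a) = (\sum_(alpha <- finsupp a) a alpha)%:C.
Proof.
rewrite ev_mask_laurent rmorph_sum /=; apply: eq_bigr => alpha _.
rewrite /monomial big1 ?mulr1 // => i _.
by rewrite mxE exp1rz.
Qed.

(** The coefficients being real, so are the values at (1, ..., 1). *)
Lemma ev_torus1 f : ev torus1 f = (value1 f)%:C.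
Proof.
suff [r fr] : exists r : R, ev torus1 f = r%:C by rewrite /value1 fr.
have [a ->] := mask_laurent_surj f.
by exists (\sum_(alpha <- finsupp a) a alpha); exact: ev_torus1_mask.
Qed.

Lemma ev_box_symbol z s : ev z (box_symbol R s) = q_poly (submx_of s) (val z).
Proof.
rewrite ev_prod; apply: eq_bigr => j _.
rewrite evM evD ev_lconst ev_lmono mulrC rmorph1; congr (_ * _).
by rewrite fmorphV rmorph_nat.
Qed.

Lemma ev_torus1_box_symbol s : ev torus1 (box_symbol R s) = 1.
Proof.
rewrite ev_box_symbol /q_poly big1 // => j _.
rewrite /monomial big1; first by rewrite divff // pnatr_eq0.
by move=> i _; rewrite mxE exp1rz.
Qed.

Lemma value1_combination (b : selection d -> laurent R d) :
  ev torus1 (\sum_(s | unimodular_selection s) b s * box_symbol R s) =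
  (\sum_(s | unimodular_selection s) value1 (b s))%:C.
Proof.
rewrite ev_sum rmorph_sum; apply: eq_bigr => s _.
by rewrite evM ev_torus1_box_symbol mulr1 ev_torus1.
Qed.

(** The values at (1, ..., 1) of the coefficients sum to 1.  Trading C q_s q_s0
    between the terms of s and s0, for every s other than s0, makes all values but
    that of s0 negative when C is large; the value of s0 is then at least 1. *)
Lemma nonvanishing_coefficients (b : selection d -> laurent R d) s0 :
  unimodular_selection s0 ->
  \sum_(s | unimodular_selection s) value1 (b s) = 1 ->
  exists2 b' : selection d -> laurent R d,
    \sum_(s | unimodular_selection s) b' s * box_symbol R s =
    \sum_(s | unimodular_selection s) b s * box_symbol R s &
    forall s, unimodular_selection s -> value1 (b' s) != 0.
Proof.
move=> s0U sum1.
pose C := 1 + \sum_(s | unimodular_selection s) `|value1 (b s)|.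
pose U' s := unimodular_selection s && (s != s0).
pose b' s := if s == s0
  then b s0 + lconst d C * \sum_(t | U' t) box_symbol R t
  else b s - lconst d C * box_symbol R s0.
have b's0 : b' s0 = b s0 + lconst d C * \sum_(t | U' t) box_symbol R t.
  by rewrite /b' eqxx.
have b'E s : U' s -> b' s = b s - lconst d C * box_symbol R s0.
  by case/andP=> _ /negbTE; rewrite /b' => ->.
have b'sum : \sum_(s | unimodular_selection s) b' s * box_symbol R s =
    \sum_(s | unimodular_selection s) b s * box_symbol R s.
  rewrite (bigD1 s0) //= [RHS](bigD1 s0) //= b's0 mulrDl -addrA; congr (_ + _).
  rewrite -mulrA [X in _ * X]mulr_suml mulr_sumr -big_split /=.
  apply: eq_bigr => s /b'E ->; rewrite mulrBl -mulrA [box_symbol R s0 * _]mulrC.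
  exact: subrKC.
have valueE s : (value1 (b' s))%:C = ev torus1 (b' s) by rewrite ev_torus1.
have neg s : U' s -> value1 (b' s) < 0.
  move=> sU'; have -> : value1 (b' s) = value1 (b s) - C.
    apply: (@complexI R); rewrite valueE b'E // evB evM ev_lconst.
    by rewrite ev_torus1_box_symbol mulr1 ev_torus1 rmorphB.
  have /andP[sU _] := sU'.
  rewrite subr_lt0 (le_lt_trans (ler_norm _)) // /C.
  rewrite (bigD1 s) //= addrCA ltrDl ltr_wpDr ?ltr01 //.
  by apply: sumr_ge0.
exists b' => // s sU; have [->|ss0] := eqVneq s s0; last first.
  by rewrite lt_eqF // neg // /U' sU ss0.
have sum1' : \sum_(s | unimodular_selection s) value1 (b' s) = 1.
  apply: (@complexI R).
  by rewrite -value1_combination b'sum value1_combination sum1.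
have : value1 (b' s0) = 1 - \sum_(t | U' t) value1 (b' t).
  by rewrite -sum1' [in RHS](bigD1 s0) //= addrK.
move=> ->; rewrite gt_eqF // subr_gt0 (le_lt_trans _ ltr01) //.
by apply: sumr_le0 => t /neg/ltW.
Qed.

End Normalization.

Theorem theoremA (R : realType) (d : nat) (d_ge1 : (1 <= d)%N) (a : Mask R d)
    (a_conv : convergent a) :
  exists (lambda : selection d -> R) (sigma : selection d -> Mask R d),
    [/\ forall s, unimodular_selection s -> symbol (sigma s) (const_mx 1) = 1,
        \sum_(s | unimodular_selection s) lambda s = 1
      & forall z : 'cV[R[i]]_d, (forall i, z i ord0 != 0) ->
          symbol a z = \sum_(s | unimodular_selection s)
            (lambda s)%:C * symbol (sigma s) z * (2 ^+ d * q_poly (submx_of s) z)].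
Proof.
have [p ap] := sum_rule_box_ideal (sum_rule a_conv).
have [s0 s0U _] := @forest_selection d (fun=> None) (fun=> erefl).
pose b s := lconst d (2 ^- d) * p s.
have ab : mask_laurent a = lconst d (2 ^+ d) *
    \sum_(s | unimodular_selection s) b s * box_symbol R s.
  rewrite ap mulr_sumr; apply: eq_bigr => s _.
  by rewrite /b !mulrA -lconstM divff ?expf_neq0 // lconst1 mul1r.
have sumb : \sum_(s | unimodular_selection s) value1 (b s) = 1.
  apply: (@mulfI _ (2 ^+ d : R)); first by rewrite expf_neq0.
  apply: (@complexI R); have := congr1 (ev (torus1 R d)) ab.
  rewrite evM ev_lconst value1_combination mulr1 -rmorphM => <-.
  rewrite ev_torus1_mask; congr (_%:C).
  rewrite (partition_big (@odd_part d) predT) //=.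
  rewrite (eq_bigr (fun=> 1)) => [|S _]; last exact: sum_rule.
  by rewrite sumr_const -cardsT -powersetT card_powerset cardsT card_ord natrX.
have [b' b'sum b'neq0] := nonvanishing_coefficients s0U sumb.
pose g s := lconst d (value1 (b' s))^-1 * b' s.
have [sigma sigmaE] := choice (fun s => mask_laurent_surj (g s)).
exists (fun s => value1 (b' s)), sigma; split=> [s sU||z z0].
- rewrite -[const_mx 1]/(val (torus1 R d)) -ev_mask_laurent -sigmaE /g evM ev_lconst.
  by rewrite ev_torus1 -rmorphM mulVf ?b'neq0.
- by apply: (@complexI R); rewrite -value1_combination b'sum value1_combination sumb.
pose w : torus R d := exist (fun z : 'cV[R[i]]_d => is_true [forall i, z i 0 != 0])
  z (introT forallP z0).
rewrite -[z]/(val w) -ev_mask_laurent ab -b'sum evM ev_sum mulr_sumr.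
apply: eq_bigr => s sU; rewrite -ev_mask_laurent -sigmaE -ev_box_symbol !evM !ev_lconst.
have cancel_lambda : (value1 (b' s))%:C * (value1 (b' s))^-1%:C = 1.
  by rewrite -rmorphM divff ?b'neq0.
rewrite [X in _ = X * _]mulrA cancel_lambda mul1r rmorphXn rmorph_nat.
by rewrite mulrCA.
Qed.
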